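(* Let $V$ be a finite set with $|V|\ge 2$. For every collection of nonnegative weights $\alpha=\{\alpha_A,\ A\subset V\}$ and every integer $N\ge 1$, $$\lambda[\alpha,N]=\lambda[\alpha,1],\qquad \kappa[\alpha,N]=\kappa[\alpha,1].$$
   Context: For $N\ge1$ let $\Omega=V^N$, with elements $\xi=(\xi_1,\dots,\xi_N)$ ($\xi_i\in V$ is the position of the labeled particle $i$), and let $\nu$ be the uniform distribution on $\Omega$. For $z\in V$ let $\eta_z=\{i:\xi_i=z\}$ be the set of labels of particles at $z$. For $A\subset V$ and $f:\Omega\to\mathbb R$ let $\nu_A f=\nu[f\mid \eta_z,\ z\notin A]$ be the conditional expectation given $\eta_z$ for all $z\notin A$ (equivalently, all particles located in $A$ are resampled independently and uniformly in $A$, the others being kept fixed). Set $\mathrm{Var}_A f=\nu_A[(f-\nu_A f)^2]$ and, for $f\ge0$, $\mathrm{Ent}_A f=\nu_A[f\log(f/\nu_A f)]$ with $0\log 0=0$; also $\mathrm{Var} f=\mathrm{Var}_V f$, $\mathrm{Ent} f=\mathrm{Ent}_V f$ (variance and entropy with respect to $\nu$). $\lambda[\alpha,N]$ is the largest $\lambda\ge0$ such that $\lambda\,\mathrm{Var} f\le\sum_{A\subset V}\alpha_A\,\nu[\mathrm{Var}_A f]$ for all $f:\Omega\to\mathbb R$. $\kappa[\alpha,N]$ is the largest $\kappa\ge0$ such that $\kappa\,\mathrm{Ent} f\le\sum_{A\subset V}\alpha_A\,\nu[\mathrm{Ent}_A f]$ for all $f:\Omega\to[0,\infty)$. *)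

(* Defs.v *)
From mathcomp Require Import all_boot all_order all_algebra.
From mathcomp Require Import boolp classical_sets reals exp.

Set Implicit Arguments.
Unset Strict Implicit.
Unset Printing Implicit Defensive.

Import Order.TTheory GRing.Theory Num.Theory.

Local Open Scope set_scope.
Local Open Scope ring_scope.

(* The space V^N of positions of N labeled particles: xi i is the position of
   particle i. *)
Definition config (V : finType) (N : nat) : finType := {ffun 'I_N -> V}.

(* The set eta_z of the labels of the particles at z. *)
Definition labels_at (V : finType) (N : nat) (xi : config V N) (z : V)
  : {set 'I_N} := [set i | xi i == z].

(* The event that eta_z takes the same value as at xi, for every z \notin A. *)
Definition atom (V : finType) (N : nat) (A : {set V}) (xi : config V N)
  : {set config V N} :=
  [set xi' | [forall (z | z \notin A), labels_at xi' z == labels_at xi z]].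

(* The mean of f under the uniform distribution on E. *)
Definition mean (R : realType) (T : finType) (E : {set T}) (f : T -> R) : R :=
  (\sum_(x in E) f x) / #|E|%:R.

Definition nu (R : realType) (V : finType) (N : nat) (f : config V N -> R) : R :=
  mean [set: config V N] f.

(* nu_A f: since nu is uniform, the conditional expectation given the finitely
   valued (eta_z), z \notin A, is the uniform mean over the atoms. *)
Definition nu_in (R : realType) (V : finType) (N : nat) (A : {set V})
  (f : config V N -> R) : config V N -> R :=
  fun xi => mean (atom A xi) f.

Definition var_in (R : realType) (V : finType) (N : nat) (A : {set V})
  (f : config V N -> R) : config V N -> R :=
  nu_in A (fun xi => (f xi - nu_in A f xi) ^+ 2).

(* The convention 0 log 0 = 0 holds because ln is total; when nu_A f = 0 and
   f >= 0, f vanishes on the whole atom and so does the integrand. *)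
Definition ent_in (R : realType) (V : finType) (N : nat) (A : {set V})
  (f : config V N -> R) : config V N -> R :=
  nu_in A (fun xi => f xi * ln (f xi / nu_in A f xi)).

Definition var (R : realType) (V : finType) (N : nat) (f : config V N -> R) : R :=
  nu (fun xi => (f xi - nu f) ^+ 2).

Definition ent (R : realType) (V : finType) (N : nat) (f : config V N -> R) : R :=
  nu (fun xi => f xi * ln (f xi / nu f)).

Definition poincare (R : realType) (V : finType) (alpha : {set V} -> R)
  (N : nat) (l : R) : Prop :=
  forall f : config V N -> R,
    l * var f <= \sum_(A : {set V}) alpha A * nu (var_in A f).

Definition ent_ineq (R : realType) (V : finType) (alpha : {set V} -> R)
  (N : nat) (k : R) : Prop :=
  forall f : config V N -> R, (forall xi, 0 <= f xi) ->
    k * ent f <= \sum_(A : {set V}) alpha A * nu (ent_in A f).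

(* The suprema below are maxima: see lambda_largest and kappa_largest. *)
Definition lambda (R : realType) (V : finType) (alpha : {set V} -> R)
  (N : nat) : R :=
  sup [set l : R | 0 <= l /\ poincare alpha N l]%classic.

Definition kappa (R : realType) (V : finType) (alpha : {set V} -> R)
  (N : nat) : R :=
  sup [set k : R | 0 <= k /\ ent_ineq alpha N k]%classic.

Section Mean.
Variables (R : realType) (T : finType).
Implicit Types (E : {set T}) (f : T -> R).

Lemma mean_ge0 E f : (forall x, x \in E -> 0 <= f x) -> 0 <= mean E f.
Proof. by move=> f0; rewrite /mean divr_ge0 ?ler0n// sumr_ge0. Qed.

Lemma ent_mean_ge0 E f : (forall x, 0 <= f x) ->
  0 <= mean E (fun x => f x * ln (f x / mean E f)).
Proof.
move=> f0; set m := mean E f.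
have m0 : 0 <= m by apply: mean_ge0 => x _.
have [mE|mN0] := eqVneq m 0.
  by apply: mean_ge0 => x _; rewrite mE invr0 mulr0 ln0// mulr0.
have mp : 0 < m by rewrite lt_def mN0.
have En0 : #|E|%:R != 0 :> R.
  by apply: contra_neq mN0 => E0; rewrite /m /mean E0 invr0 mulr0.
rewrite /mean divr_ge0 ?ler0n//.
have s0 : \sum_(x in E) (f x - m) = 0.
  rewrite sumrB sumr_const -[m *+ _]mulr_natr /m /mean divfK//; exact: subrr.
rewrite -[X in X <= _]s0; apply: ler_sum => x _.
have [fx0|fxN0] := eqVneq (f x) 0; first by rewrite fx0 !mul0r sub0r oppr_le0.
have fp : 0 < f x by rewrite lt_def fxN0 f0.
have h : ln (m / f x) <= m / f x - 1.
  have := @le_ln1Dx R (m / f x - 1).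
  rewrite [1 + _]addrC subrK; apply.
  by rewrite ltrBrDr addNr divr_gt0.
have lnE : ln (f x / m) = - ln (m / f x).
  by rewrite -lnV ?invf_div // posrE divr_gt0.
have := ler_wpM2l (ltW fp) h.
rewrite mulrBr mulr1 mulrCA divff// mulr1 lnE mulrN => h'.
by rewrite -lerN2 opprK opprB.
Qed.

End Mean.

Section Largest.
Variables (R : realType) (V : finType) (N : nat).
Implicit Types (A : {set V}) (f : config V N -> R) (xi : config V N).

Lemma nu_in_atom A f xi xi' :
  xi' \in atom A xi -> nu_in A f xi' = nu_in A f xi.
Proof.
move=> h; rewrite /nu_in; congr mean.
move: h; rewrite inE => /forall_inP h.
apply/setP => y; rewrite !inE; apply: eq_forallb_in => z zA.
by rewrite (eqP (h z zA)).
Qed.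

Lemma nu_in_setT f xi : nu_in [set: V] f xi = nu f.
Proof.
rewrite /nu_in /nu; congr mean.
by apply/setP => y; rewrite !inE; apply/forall_inP => z; rewrite inE.
Qed.

Lemma var_in_setT f xi : var_in [set: V] f xi = var f.
Proof.
rewrite /var_in nu_in_setT /var; congr nu.
by apply/funext => y; rewrite nu_in_setT.
Qed.

Lemma ent_in_setT f xi : ent_in [set: V] f xi = ent f.
Proof.
rewrite /ent_in nu_in_setT /ent; congr nu.
by apply/funext => y; rewrite nu_in_setT.
Qed.

Lemma var_in_ge0 A f xi : 0 <= var_in A f xi.
Proof. by apply: mean_ge0 => x _; exact: sqr_ge0. Qed.

Lemma ent_in_ge0 A f xi : (forall x, 0 <= f x) -> 0 <= ent_in A f xi.
Proof.
move=> f0; have := ent_mean_ge0 (atom A xi) f0.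
congr (_ <= _ / _); apply: eq_bigr => x xA.
by rewrite (@nu_in_atom A f xi x xA).
Qed.

Variable alpha : {set V} -> R.
Hypothesis alpha0 : forall A, 0 <= alpha A.

Lemma sup_largest (P : (config V N -> R) -> Prop)
    (F G : (config V N -> R) -> R) f0 :
  P f0 -> 0 < F f0 -> (forall f, P f -> 0 <= F f) ->
  (forall f, P f -> 0 <= G f) ->
  let S := [set l : R | 0 <= l /\ forall f, P f -> l * F f <= G f]%classic in
  S (sup S) /\ forall l, S l -> l <= sup S.
Proof.
move=> Pf0 Ff0 F0 G0 S.
have S0 : S 0 by split=> // f Pf; rewrite mul0r G0.
have Sub l f : S l -> P f -> 0 < F f -> l <= G f / F f.
  by move=> [_ Sl] Pf Ff; rewrite ler_pdivlMr// Sl.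
have ubS : has_ubound S by exists (G f0 / F f0) => l Sl; exact: Sub.
split; last by move=> l Sl; exact: ub_le_sup.
split; first exact: ub_le_sup.
move=> f Pf; have [FE|FN0] := eqVneq (F f) 0; first by rewrite FE mulr0 G0.
have Fp : 0 < F f by rewrite lt_def FN0 F0.
rewrite -ler_pdivlMr//; apply: ge_sup; first by exists 0.
by move=> l Sl; exact: Sub.
Qed.

Hypotheses (V2 : (1 < #|V|)%N) (N0 : (0 < N)%N).

Lemma card_config : (1 < #|config V N|)%N.
Proof.
rewrite /config card_ffun card_ord.
case: N N0 => // n _.
by rewrite -[X in (X < _)%N](exp1n n.+1) ltn_exp2r.
Qed.

Let M : R := #|config V N|%:R.

Lemma M_gt1 : 1 < M. Proof. by rewrite /M ltr1n card_config. Qed.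

Lemma nu_delta x0 f : (forall x, x != x0 -> f x = 0) -> nu f = f x0 / M.
Proof.
move=> h; rewrite /nu /mean cardsT (bigD1 x0) ?inE//=.
by rewrite big1 ?addr0// => x /andP[_ /h].
Qed.

Lemma test_fun : exists f, [/\ forall x, 0 <= f x, 0 < var f & 0 < ent f].
Proof.
have [x0 _] : exists x0 : config V N, x0 \in [set: config V N].
  by apply/set0Pn; rewrite -card_gt0 cardsT (ltn_trans _ card_config).
have M1 := M_gt1; have Mp : 0 < M by apply: lt_trans M1.
exists (fun x => (x == x0)%:R); set f := (fun x => _).
have nuf : nu f = M^-1.
  by rewrite (@nu_delta x0) /f ?eqxx ?mul1r// => x /negPf ->.
split.
- by move=> x; rewrite ler0n.
- rewrite /var nuf /nu /mean cardsT divr_gt0//.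
  rewrite (bigD1 x0) ?inE//= ltr_pwDl//; last first.
    by apply: sumr_ge0 => x _; exact: sqr_ge0.
  rewrite exprn_gt0// /f eqxx subr_gt0 invf_lt1//.
- rewrite /ent nuf (@nu_delta x0); last by move=> x /negPf; rewrite /f => ->;
    rewrite mul0r.
  by rewrite /f eqxx mul1r invrK mul1r divr_gt0// ln_gt0.
Qed.

Lemma lambda_largest :
  [/\ 0 <= lambda alpha N, poincare alpha N (lambda alpha N) &
      forall l, 0 <= l -> poincare alpha N l -> l <= lambda alpha N].
Proof.
have [f0 [f00 vf0 _]] := test_fun.
have [] := @sup_largest (fun=> True) (@var R V N)
  (fun f => \sum_(A : {set V}) alpha A * nu (var_in A f)) f0 I vf0.
- by move=> f _; apply: mean_ge0 => x _; exact: sqr_ge0.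
- move=> f _; apply: sumr_ge0 => A _; apply: mulr_ge0 => //.
  by apply: mean_ge0 => x _; exact: var_in_ge0.
set S := (X in sup X).
have -> : sup S = lambda alpha N.
  rewrite /lambda; congr sup; apply/seteqP; split=> l [l0 Hl]; split=> // f.
  exact: Hl.
move=> [l0 h] ub; split=> // [f|l ? hl]; first exact: h.
by apply: ub; split=> // f _; exact: hl.
Qed.

Lemma kappa_largest :
  [/\ 0 <= kappa alpha N, ent_ineq alpha N (kappa alpha N) &
      forall k, 0 <= k -> ent_ineq alpha N k -> k <= kappa alpha N].
Proof.
have [f0 [f00 _ ef0]] := test_fun.
have [] := @sup_largest (fun f => forall x, 0 <= f x) (@ent R V N)
  (fun f => \sum_(A : {set V}) alpha A * nu (ent_in A f)) f0 f00 ef0.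
- by move=> f h; exact: ent_mean_ge0.
- move=> f h; apply: sumr_ge0 => A _; apply: mulr_ge0 => //.
  by apply: mean_ge0 => x _; exact: ent_in_ge0.
by move=> [l0 h] ub; split=> // k ? hk; exact: ub.
Qed.

End Largest.

(* Main.v *)
(* The conditional expectation nu_A is the N-fold tensor power of the
   one-particle operator that averages over A.  Both var and ent are entropies
   nu[phi f] - phi(nu f), with phi x = x^2 and phi x = x ln x, and both are
   convex functionals of f.  Let f depend on (x, y), x the first particle and y
   the others, and let h be its average over x.  By the chain rule,
     Ent f = nu[Ent(f(., y))] + Ent h,
   and the same rule splits the conditional entropy Ent_A.  By convexity,
   averaging over y does not increase the average of the entropies in x, so
     nu[Ent_A f] >= nu[Ent_A(f(., y))] + nu[Ent_A h],
   where the first term on the right resamples x only.  The inequality for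
   N + 1 particles thus follows from those for 1 and for N particles; the
   converse is obtained with functions of a single particle. *)
Require Import Defs.
From mathcomp Require Import all_boot all_order all_algebra.
From mathcomp Require Import boolp reals exp.
From mathcomp Require Import ring lra.

Set Implicit Arguments.
Unset Strict Implicit.
Unset Printing Implicit Defensive.

Import Order.TTheory GRing.Theory Num.Theory.

Local Open Scope ring_scope.

(** * Uniform means, variance and entropy identities, log-sum inequality *)

Section MeanTheory.
Variable R : realType.
Implicit Types S T : finType.

Lemma eq_mean T (E : {set T}) (f g : T -> R) :
  {in E, f =1 g} -> mean E f = mean E g.
Proof. by move=> fg; congr (_ / _); apply: eq_bigr. Qed.

Lemma mean_set0 T (f : T -> R) : mean set0 f = 0.
Proof. by rewrite /mean big_set0 mul0r. Qed.

Lemma meanB T (E : {set T}) (f g : T -> R) :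
  mean E (fun x => f x - g x) = mean E f - mean E g.
Proof. by rewrite /mean sumrB mulrBl. Qed.

Lemma meanD T (E : {set T}) (f g : T -> R) :
  mean E (fun x => f x + g x) = mean E f + mean E g.
Proof. by rewrite /mean big_split mulrDl. Qed.

Lemma meanMr T (E : {set T}) (f : T -> R) c :
  mean E (fun x => f x * c) = mean E f * c.
Proof. by rewrite /mean -mulr_suml mulrAC. Qed.

Lemma mean_const T (E : {set T}) (c : R) : E != set0 -> mean E (fun=> c) = c.
Proof.
rewrite -card_gt0 -(ltr0n R) => E0.
by rewrite /mean sumr_const -[c *+ _]mulr_natr mulfK// gt_eqF.
Qed.

Lemma le_mean T (E : {set T}) (f g : T -> R) :
  (forall x, x \in E -> f x <= g x) -> mean E f <= mean E g.
Proof. by move=> fg; rewrite ler_wpM2r ?invr_ge0// ler_sum. Qed.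

Lemma exchange_mean S T (A : {set S}) (B : {set T}) (f : S -> T -> R) :
  mean A (fun x => mean B (f x)) = mean B (fun y => mean A (f^~ y)).
Proof.
by rewrite /mean -!mulr_suml exchange_big/= mulrAC.
Qed.

Lemma mean_setX S T (A : {set S}) (B : {set T}) (f : S * T -> R) :
  mean (setX A B) f = mean A (fun x => mean B (fun y => f (x, y))).
Proof.
rewrite /mean cardsX natrM invfM -mulr_suml pair_big_dep/= -mulrA.
rewrite [_^-1 * _^-1]mulrC; congr (_ * _).
by apply: eq_big => -[x y]//=; rewrite inE.
Qed.

Lemma mean_setTX S T (f : S * T -> R) :
  mean setT f = mean setT (fun x => mean setT (fun y => f (x, y))).
Proof. by rewrite -mean_setX; congr mean; apply/setP => x; rewrite !inE. Qed.

Lemma mean_imset S T (c : S -> T) (E : {set S}) (f : T -> R) :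
  injective c -> mean (c @: E) f = mean E (f \o c).
Proof.
move=> ci; rewrite /mean card_imset// big_imset//=.
by move=> x y _ _; exact: ci.
Qed.

Lemma sqr_mean T (E : {set T}) (f : T -> R) : E != set0 ->
  mean E (fun x => (f x - mean E f) ^+ 2)
  = mean E (fun x => f x ^+ 2) - mean E f ^+ 2.
Proof.
move=> E0; set m := mean E f.
transitivity (mean E (fun x => f x ^+ 2 - f x * (m *+ 2) + m ^+ 2)).
  by apply: eq_mean => x _; ring.
by rewrite meanD meanB meanMr mean_const// -/m; ring.
Qed.

Lemma mean_eq0 T (E : {set T}) (f : T -> R) :
  (forall x, 0 <= f x) -> mean E f = 0 -> forall x, x \in E -> f x = 0.
Proof.
move=> f0 /eqP; rewrite mulf_eq0 invr_eq0 pnatr_eq0 cards_eq0 => /orP[|/eqP->].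
  rewrite psumr_eq0 // => /allP h x xE; apply/eqP.
  by have := h x (mem_index_enum x); rewrite xE.
by move=> x; rewrite inE.
Qed.

(** With [ln 0 = 0], the implication from [b = 0] to [a = 0] rules out the one bad case, [a > 0] and
    [b = 0]. *)
Lemma mulr_ln_div (a b : R) : 0 <= a -> 0 <= b -> (b = 0 -> a = 0) ->
  a * ln (a / b) = a * ln a - a * ln b.
Proof.
move=> a0 b0 ba; have [->|aN0] := eqVneq a 0; first by rewrite !mul0r subr0.
have ap : 0 < a by rewrite lt_def aN0.
have bp : 0 < b by rewrite lt_def b0 andbT; apply: contra_neq aN0.
by rewrite ln_div ?posrE// mulrBr.
Qed.

Lemma ln_mean T (E : {set T}) (f : T -> R) : (forall x, 0 <= f x) ->
  mean E (fun x => f x * ln (f x / mean E f))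
  = mean E (fun x => f x * ln (f x)) - mean E f * ln (mean E f).
Proof.
move=> f0; rewrite -meanMr -meanB; apply: eq_mean => x xE.
apply: mulr_ln_div => //; first by apply: mean_ge0.
by move=> /mean_eq0; apply.
Qed.

(* Log-sum inequality; with the junk value ln 0 = 0 it needs the domination
   hypothesis. *)
Lemma log_mean T (E : {set T}) (a b : T -> R) :
  (forall x, 0 <= a x) -> (forall x, 0 <= b x) ->
  (forall x, b x = 0 -> a x = 0) ->
  mean E a * ln (mean E a / mean E b) <= mean E (fun x => a x * ln (a x / b x)).
Proof.
move=> a0 b0 ba; set s := mean E a; set t := mean E b.
have s0 : 0 <= s by apply: mean_ge0.
have t0 : 0 <= t by apply: mean_ge0.
have [sE|sN0] := eqVneq s 0.
  rewrite sE mul0r; apply: mean_ge0 => x xE.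
  by rewrite (mean_eq0 a0 sE xE) mul0r.
have sp : 0 < s by rewrite lt_def sN0.
have tN0 : t != 0.
  apply: contra_neq sN0 => tE; rewrite /s /mean big1 ?mul0r// => x xE.
  by apply/ba; exact: (mean_eq0 b0 tE).
have tp : 0 < t by rewrite lt_def tN0.
(* The added term [a x - b x * (s / t)] has mean [s - t * (s / t) = 0]; with it the inequality holds
   pointwise. *)
have -> : s * ln (s / t) =
    mean E (fun x => a x * ln (s / t) + (a x - b x * (s / t))).
  by rewrite meanD meanB !meanMr -/s -/t mulrCA divff// mulr1 subrr addr0.
apply: le_mean => x _.
have [ax0|axN0] := eqVneq (a x) 0.
  by rewrite ax0 !mul0r !add0r oppr_le0 mulr_ge0// divr_ge0.
have ap : 0 < a x by rewrite lt_def axN0 a0.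
have bp : 0 < b x by rewrite lt_def b0 andbT; apply: contra_neq axN0 => /ba.
have rp : 0 < s / t by rewrite divr_gt0.
move: (s / t) rp => r rp.
(* This is [ln u <= u - 1] at [u = b x * r / a x], to be multiplied by [a x]. *)
have := @le_ln1Dx R (b x * r / a x - 1).
rewrite [1 + _]addrC subrK ltrBrDr addNr divr_gt0 ?mulr_gt0// => /(_ isT).
move=> /(ler_wpM2l (ltW ap)).
rewrite !(ln_div, lnM) ?posrE ?mulr_gt0// [in X in _ <= X]mulrBr mulr1.
rewrite mulrCA divff// mulr1; lra.
Qed.

End MeanTheory.

(** * Phi-entropies and their tensorization over product spaces *)

Section PhiEntropy.
Variables (R : realType) (D : R -> Prop) (phi : R -> R).
Implicit Types S T : finType.

Definition phi_ent S (u : S -> R) : R :=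
  mean setT (phi \o u) - phi (mean setT u).

(** [D] is the set of values allowed for test functions: all reals for the variance, the nonnegative
    reals for the entropy. *)
Definition mean_closed : Prop := forall T (E : {set T}) (f : T -> R),
  (forall x, D (f x)) -> D (mean E f).

(** This is Jensen's inequality for the functional [phi_ent], restricted to uniform weights. *)
Definition convex_phi_ent : Prop :=
  forall S T (E : {set T}) (g : T -> S -> R), E != set0 ->
  (forall y x, D (g y x)) ->
  phi_ent (fun x => mean E (g^~ x)) <= mean E (fun y => phi_ent (g y)).

Variables (I : finType) (alpha : I -> R).

(* p a x is the block containing x of the partition of T with index a. *)
Definition blocks T (p : I -> T -> {set T}) : Prop :=
  (forall a x, x \in p a x) /\ (forall a x y, y \in p a x -> p a y = p a x).

Definition cond T (p : I -> T -> {set T}) (a : I) (f : T -> R) : T -> R :=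
  fun x => mean (p a x) f.

(** Each difference on the right is the average over blocks of the conditional phi-entropy, since
    the mean of [phi \o f] is unchanged by conditioning first. *)
Definition phi_ineq T (p : I -> T -> {set T}) (l : R) : Prop :=
  forall f : T -> R, (forall x, D (f x)) ->
  l * phi_ent f <= \sum_a alpha a *
    (mean setT (phi \o f) - mean setT (phi \o cond p a f)).

Lemma block_sym T (p : I -> T -> {set T}) a x y :
  blocks p -> (y \in p a x) = (x \in p a y).
Proof. by move=> [pr pc]; apply/idP/idP => /pc->. Qed.

Lemma block_neq0 T (p : I -> T -> {set T}) a x : blocks p -> p a x != set0.
Proof. by move=> [pr _]; apply/set0Pn; exists x. Qed.

(** Tower property: after exchanging the sums, [f y] is counted once for each [x] in the block of
    [y], with weight one over the size of that block. *)
Lemma mean_cond T (p : I -> T -> {set T}) a (f : T -> R) :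
  blocks p -> mean setT (cond p a f) = mean setT f.
Proof.
move=> pb; congr (_ / _).
rewrite /cond /mean; under eq_bigr => x _ do rewrite mulr_suml.
rewrite (exchange_big_dep predT)//=.
under [RHS]eq_bigl do rewrite inE.
apply: eq_bigr => y _.
transitivity (\sum_(x in p a y) f y / #|p a y|%:R).
  apply: eq_big => x; first by rewrite inE /= block_sym.
  by move=> /andP[_ /(pb.2)->].
by rewrite -[RHS](mean_const (f y) (block_neq0 a y pb)) /mean mulr_suml.
Qed.

(** If [c] carries the uniform laws of [T] and of its blocks to those of [S] and its blocks, testing
    on functions [f \o c] gives the inequality on [S]. It serves both for a bijection and for the
    projection to one particle. *)
Lemma phi_ineq_factor S T (p : I -> S -> {set S}) (q : I -> T -> {set T})
    (c : T -> S) l :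
  (forall g : S -> R, mean setT (g \o c) = mean setT g) ->
  (forall a y (g : S -> R), mean (q a y) (g \o c) = mean (p a (c y)) g) ->
  phi_ineq q l -> phi_ineq p l.
Proof.
move=> cT cE H f fD.
have := H (f \o c) (fun y => fD (c y)).
rewrite /phi_ent (cT (phi \o f)) cT.
congr (_ <= _); apply: eq_bigr => a _; congr (_ * (_ - _)).
by rewrite -[RHS]cT; congr mean; apply/funext => y /=; rewrite /cond cE.
Qed.

Definition prod_blocks S T (p : I -> S -> {set S}) (q : I -> T -> {set T}) :
  I -> S * T -> {set S * T} := fun a z => setX (p a z.1) (q a z.2).

Hypotheses (Dmean : mean_closed) (phi_convex : convex_phi_ent).

(** Convexity applies in each block of [q]; the tower property then removes the block averages on
    the right. *)
Lemma mean_phi_ent_cond S T (q : I -> T -> {set T}) a (g : T -> S -> R) :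
  blocks q -> (forall y x, D (g y x)) ->
  mean setT (fun y => phi_ent (fun x => cond q a (g^~ x) y))
  <= mean setT (fun y => phi_ent (g y)).
Proof.
move=> qb gD; rewrite -(mean_cond a (fun y => phi_ent (g y)) qb).
by apply: le_mean => y _; apply: phi_convex => //; exact: block_neq0.
Qed.

Hypothesis alpha0 : forall a, 0 <= alpha a.

Lemma phi_ineq_prod S T (p : I -> S -> {set S}) (q : I -> T -> {set T}) l :
  blocks p -> blocks q -> phi_ineq p l -> phi_ineq q l ->
  phi_ineq (prod_blocks p q) l.
Proof.
move=> pb qb Hp Hq f fD.
pose fy y x := f (x, y); pose h y := mean setT (fy y).
have swap (g : S * T -> R) :
    mean setT g = mean setT (fun y => mean setT (fun x => g (x, y))).
  by rewrite mean_setTX exchange_mean.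
have chain : phi_ent f = mean setT (fun y => phi_ent (fy y)) + phi_ent h.
  by rewrite /phi_ent meanB !swap addrA subrK.
have Hh := Hq h (fun y => Dmean _ (fun x => fD (x, y))).
(* The inequality for [p], applied at each fixed [y], is averaged over [y]. *)
have Hf : l * mean setT (fun y => phi_ent (fy y)) <= \sum_a alpha a *
    mean setT (fun y => mean setT (phi \o fy y)
      - mean setT (phi \o cond p a (fy y))).
  rewrite mulrC -meanMr.
  apply: (@le_trans _ _ (mean setT (fun y => \sum_a alpha a *
      (mean setT (phi \o fy y) - mean setT (phi \o cond p a (fy y)))))).
    by apply: le_mean => y _; rewrite mulrC; apply: Hp => x; exact: fD.
  rewrite /mean exchange_big/= mulr_suml le_eqVlt.
  by apply/predU1l/eq_bigr => a _; rewrite mulrA -mulr_sumr.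
rewrite chain mulrDr; apply: (le_trans (lerD Hf Hh)).
rewrite -big_split; apply: ler_sum => a _ /=.
rewrite -mulrDr ler_wpM2l//.
(* [g] averages over the [p]-block only. Averaging it further over the [q]-block gives the
   conditional mean on the product; averaging it over all [x] gives [h]. *)
pose g y x := cond p a (fy y) x.
have gD y x : D (g y x) by apply: Dmean => z; exact: fD.
have := mean_phi_ent_cond a qb gD.
rewrite /phi_ent !meanB.
have -> : mean setT (fun y => phi (mean setT (g y))) = mean setT (phi \o h).
  by apply: eq_mean => y _ /=; rewrite mean_cond.
have -> : mean setT (fun y => phi (mean setT (fun x => cond q a (g^~ x) y)))
        = mean setT (phi \o cond q a h).
  apply: eq_mean => y _ /=; rewrite {1}/cond exchange_mean; congr phi.
  by apply: eq_mean => z _; rewrite mean_cond.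
have -> : mean setT (phi \o cond (prod_blocks p q) a f)
    = mean setT (fun y => mean setT (phi \o (fun x => cond q a (g^~ x) y))).
  rewrite swap; apply: eq_mean => y _; apply: eq_mean => x _ /=.
  by rewrite /cond /prod_blocks mean_setX exchange_mean.
rewrite (swap (phi \o f)) /g /=.
(* The convexity bound and the goal are now linear in the same five means. *)
set c1 := mean _ _; set c2 := mean _ _; set c3 := mean _ _.
set c4 := mean _ _; set c5 := mean _ _; lra.
Qed.

End PhiEntropy.

(** * Convexity of the variance and of the entropy *)

Section Instances.
Variable R : realType.

Lemma mean_closed_True : @mean_closed R (fun=> True).
Proof. by []. Qed.

Lemma mean_closed_ge0 : @mean_closed R (fun x => 0 <= x).
Proof. by move=> T E f f0; apply: mean_ge0. Qed.

(** At fixed [x], with [a y = g y x - mean setT (g y)], the claim is that the square of the mean of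
    [a] is at most the mean of its square; the gap is a variance in [y]. *)
Lemma convex_sqr : @convex_phi_ent R (fun=> True) (fun x => x ^+ 2).
Proof.
move=> S T E g E0 _; rewrite /phi_ent.
(* [sqr_mean] needs a nonempty set; over an empty [S] every mean is 0. *)
have [S0|SN0] := eqVneq [set: S] set0.
  rewrite S0 !mean_set0 expr0n subr0; apply: mean_ge0 => y _.
  by rewrite !mean_set0 expr0n subr0.
rewrite /comp -sqr_mean//.
under [leRHS]eq_mean => y _ do rewrite -sqr_mean//.
rewrite [leRHS]exchange_mean; apply: le_mean => x _.
rewrite [X in _ - X]exchange_mean -meanB -subr_ge0 -sqr_mean//.
by apply: mean_ge0 => y _; exact: sqr_ge0.
Qed.

(** At fixed [x] this is the log-sum inequality in [y] between [g y x] and the mean of [g y];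
    domination holds because a nonnegative function of mean zero vanishes. *)
Lemma convex_xlnx : @convex_phi_ent R (fun x => 0 <= x) (fun x => x * ln x).
Proof.
move=> S T E g E0 g0; rewrite /phi_ent /comp -ln_mean; last first.
  by move=> x; apply: mean_ge0.
under [leRHS]eq_mean => y _ do rewrite -ln_mean//.
rewrite [leRHS]exchange_mean; apply: le_mean => x _.
rewrite [X in _ / X]exchange_mean; apply: log_mean => // y.
- by apply: mean_ge0.
- by move=> /mean_eq0; apply=> //; rewrite inE.
Qed.

End Instances.

(** * Product structure of configurations and induction on the number of particles *)

Section Configurations.
Variable V : finType.

(** The atom of [A] for a single particle: it moves freely inside [A] and is frozen outside. *)
Definition one_block (A : {set V}) (x : V) : {set V} :=
  if x \in A then A else [set x].

Lemma blocks_one_block : blocks one_block.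
Proof.
split=> [A x|A x y]; rewrite /one_block.
  by case: ifP => //; rewrite inE.
case: (boolP (x \in A)) => [_ ->//|xA].
by rewrite inE => /eqP->; rewrite (negPf xA).
Qed.

(** Fixing the label sets outside [A] constrains each particle separately: one at a site outside [A]
    stays there, and one inside [A] cannot leave, since it would join a label set that is fixed. *)
Lemma in_atom n (A : {set V}) (xi xi' : config V n) :
  (xi' \in atom A xi) = [forall i, xi' i \in one_block A (xi i)].
Proof.
rewrite inE; apply/forall_inP/forallP => /= [h i|h z zA].
  rewrite /one_block; case: ifPn => [xA|xA]; last first.
    by have /eqP/setP/(_ i) := h _ xA; rewrite !inE eqxx => ->.
  apply: contraLR xA => x'A.
  by have /eqP/setP/(_ i) := h _ x'A; rewrite !inE eqxx => /esym/eqP->.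
have zF x : x \in A -> (x == z) = false.
  by move=> xA; apply: contraNF zA => /eqP<-.
apply/eqP/setP => i; rewrite !inE; have := h i; rewrite /one_block.
by case: ifP => [xA x'A|_]; [rewrite !zF | rewrite inE => /eqP->].
Qed.

Lemma blocks_atom n : blocks (fun A => @atom V n A).
Proof.
split=> [A xi|A xi xi'].
  by rewrite in_atom; apply/forallP => i; apply: blocks_one_block.1.
rewrite in_atom => /forallP h; apply/setP => y; rewrite !in_atom.
by apply: eq_forallb => i; rewrite (blocks_one_block.2 _ _ _ (h i)).
Qed.

Definition config_cons n (z : V * config V n) : config V n.+1 :=
  [ffun i => if unlift ord0 i is Some j then z.2 j else z.1].

Definition config_uncons n (xi : config V n.+1) : V * config V n :=
  (xi ord0, [ffun j => xi (lift ord0 j)]).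

Lemma config_consK n : cancel (@config_cons n) (@config_uncons n).
Proof.
case=> x xi; congr pair; first by rewrite ffunE unlift_none.
by apply/ffunP => j; rewrite !ffunE liftK.
Qed.

Lemma config_unconsK n : cancel (@config_uncons n) (@config_cons n).
Proof.
move=> xi; apply/ffunP => i; rewrite ffunE.
by case: unliftP => [j|] ->//=; rewrite ffunE.
Qed.

Lemma atom_cons n (A : {set V}) (z : V * config V n) :
  atom A (config_cons z) =
  @config_cons n @: prod_blocks one_block (fun A => @atom V n A) A z.
Proof.
apply/setP => xi; rewrite -[xi]config_unconsK.
case: z (config_uncons xi) => x0 z0 [x1 z1].
rewrite mem_imset; last exact: can_inj (@config_consK n).
rewrite in_setX !in_atom; apply/forallP/andP => [h|[h0 /forallP h] i] /=.
  split; first by have := h ord0; rewrite !ffunE unlift_none.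
  by apply/forallP => j; have := h (lift ord0 j); rewrite !ffunE liftK.
by rewrite !ffunE; case: unliftP => [j|] _ //; exact: h.
Qed.

Lemma setT_cons n : [set: config V n.+1] = @config_cons n @: setT.
Proof.
apply/setP => xi; rewrite inE -[xi]config_unconsK.
by rewrite mem_imset ?inE //; apply: can_inj (@config_consK n).
Qed.

Variables (R : realType) (D : R -> Prop) (phi : R -> R) (alpha : {set V} -> R).
Hypotheses (Dmean : mean_closed D) (phi_convex : convex_phi_ent D phi).
Hypothesis alpha0 : forall A, 0 <= alpha A.

Lemma phi_ineq_config n l : phi_ineq D phi alpha one_block l ->
  phi_ineq D phi alpha (fun A => @atom V n A) l.
Proof.
move=> H; elim: n => [|n IH].
  move=> f _.
  (* The induction starts from no particles: there is a single configuration, so every function is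
     constant and both sides vanish. *)
  have [|xi0 xiE] := @fintype1 (config V 0).
    by rewrite card_ffun card_ord.
  have xi_in : [set: config V 0] != set0.
    by apply/set0Pn; exists xi0; rewrite inE.
  have -> : f = fun=> f xi0 by apply/funext => xi; rewrite (xiE xi).
  rewrite /phi_ent /comp !mean_const// subrr mulr0.
  rewrite big1// => A _; rewrite -[X in _ - X]/(mean _ _).
  rewrite (@eq_mean _ _ _ _ (fun=> phi (f xi0))) ?mean_const// ?subrr ?mulr0//.
  by move=> xi _; rewrite /cond mean_const//; exact: block_neq0 (@blocks_atom 0).
have consI := can_inj (@config_consK n).
apply: (phi_ineq_factor _ _ (phi_ineq_prod Dmean phi_convex alpha0
  blocks_one_block (@blocks_atom n) H IH) (c := @config_cons n)).
- by move=> g; rewrite setT_cons mean_imset.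
- by move=> A z g; rewrite atom_cons mean_imset.
Qed.

(** Test functions depending on particle [ord0] alone suffice: its marginal is uniform on [V], and
    uniform on its own block under each atom. *)
Lemma phi_ineq_one n l : phi_ineq D phi alpha (fun A => @atom V n.+1 A) l ->
  phi_ineq D phi alpha one_block l.
Proof.
have consI := can_inj (@config_consK n).
have evE (g : V -> R) x (xi : config V n) :
    g (config_cons (x, xi) ord0) = g x by rewrite ffunE unlift_none.
apply: (phi_ineq_factor (c := fun xi : config V n.+1 => xi ord0)).
- move=> g; rewrite setT_cons mean_imset// mean_setTX.
  apply: eq_mean => x _; under eq_mean => xi _ do rewrite /= evE.
  by apply: mean_const; apply/set0Pn; exists [ffun=> x]; rewrite inE.
- move=> A xi g; rewrite -[xi]config_unconsK atom_cons mean_imset// mean_setX.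
  rewrite ffunE unlift_none; apply: eq_mean => x _.
  under eq_mean => y _ do rewrite /= evE.
  by apply: mean_const; exact: block_neq0 (@blocks_atom n).
Qed.

Lemma phi_ineqE N l : (0 < N)%N ->
  phi_ineq D phi alpha (fun A => @atom V N A) l <->
  phi_ineq D phi alpha one_block l.
Proof.
by case: N => // n _; split; [exact: phi_ineq_one | exact: phi_ineq_config].
Qed.

End Configurations.

(** * Variance and entropy inequalities as phi-entropy inequalities *)

Section Bridge.
Variables (R : realType) (V : finType) (alpha : {set V} -> R) (N : nat).
Implicit Types (A : {set V}) (f : config V N -> R).

(** [nu_in A f] is constant on each atom, so [sqr_mean] applies atom by atom; the tower property
    handles the mean of [f ^+ 2]. *)
Lemma nu_var_in A f : nu (var_in A f) =
  nu (fun xi => f xi ^+ 2) - nu (fun xi => nu_in A f xi ^+ 2).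
Proof.
rewrite -[X in X - _](mean_cond A _ (@blocks_atom V N)) /nu -meanB.
apply: eq_mean => xi _; rewrite /cond -sqr_mean.
  by apply: eq_mean => xi' h; rewrite (nu_in_atom _ h).
exact: block_neq0 (@blocks_atom V N).
Qed.

Lemma nu_ent_in A f : (forall xi, 0 <= f xi) -> nu (ent_in A f) =
  nu (fun xi => f xi * ln (f xi))
  - nu (fun xi => nu_in A f xi * ln (nu_in A f xi)).
Proof.
move=> f0.
rewrite -[X in X - _](mean_cond A _ (@blocks_atom V N)) /nu -meanB.
apply: eq_mean => xi _; rewrite /cond -ln_mean//.
by apply: eq_mean => xi' h; rewrite (nu_in_atom _ h).
Qed.

Lemma poincareE l : (0 < #|V|)%N -> poincare alpha N l <->
  phi_ineq (fun=> True) (fun x => x ^+ 2) alpha (fun A => @atom V N A) l.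
Proof.
move=> V0; have E0 : [set: config V N] != set0.
  by have /card_gt0P[x _] := V0; apply/set0Pn; exists [ffun=> x]; rewrite inE.
have varE f : var f = phi_ent (fun x => x ^+ 2) f by exact: sqr_mean.
split=> H f => [_|]; [have := H f | have := H f (fun=> I)]; rewrite varE;
  congr (_ <= _); apply: eq_bigr => A _; by rewrite nu_var_in.
Qed.

Lemma ent_ineqE l : ent_ineq alpha N l <->
  phi_ineq (fun x => 0 <= x) (fun x => x * ln x) alpha (fun A => @atom V N A) l.
Proof.
have entE f : (forall xi, 0 <= f xi) -> ent f = phi_ent (fun x => x * ln x) f.
  exact: ln_mean.
by split=> H f f0; have := H f f0; rewrite entE//; congr (_ <= _);
  apply: eq_bigr => A _; rewrite nu_ent_in.
Qed.

End Bridge.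

Theorem theorem1p4 (R : realType) (V : finType) (hV : (2 <= #|V|)%N)
  (alpha : {set V} -> R) (halpha : forall A : {set V}, 0 <= alpha A)
  (N : nat) (hN : (1 <= N)%N) :
  lambda alpha N = lambda alpha 1%N /\ kappa alpha N = kappa alpha 1%N.
Proof.
have V0 : (0 < #|V|)%N by exact: ltnW.
(* The sets under the two suprema are equal: for each [l], both inequalities are equivalent to the
   one for [one_block], in which the number of particles does not occur. *)
split; rewrite /lambda /kappa; congr reals.sup;
  apply/funext => l; congr (_ /\ _); apply/propext.
- by rewrite !poincareE// !(phi_ineqE (@mean_closed_True R) (@convex_sqr R)).
- by rewrite !ent_ineqE !(phi_ineqE (@mean_closed_ge0 R) (@convex_xlnx R)).
Qed.
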